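(* For all integers $r\ge 3$ and $d\ge 1$, $$\chi_s^r(d)\le \left\lceil \left(2^{3r+1}\,3^3\,(rd)^3\right)^{\frac{1}{r-1}}\right\rceil .$$
   Context: All hypergraphs are finite. A hypergraph is $r$-uniform if every hyperedge has exactly $r$ vertices; $K_n^r$ is the complete $r$-uniform hypergraph on $n$ vertices; $\Delta(H)$ is the maximum vertex degree of $H$ (the degree of a vertex is the number of hyperedges containing it). Subhypergraphs are understood as formed by a set of hyperedges together with the vertices in their union. A hyperedge is monochromatic under a vertex coloring if all its vertices have the same color; a subhypergraph is bicolored if its vertices receive exactly two colors. A star is a hypergraph formed by hyperedges $E_1,\dots,E_m$, $m\ge 2$, with $\bigcap_i E_i\ne\emptyset$. A star coloring of a hypergraph $H$ is a vertex coloring of $H$ with no monochromatic hyperedge in which the only bicolored connected subhypergraphs with at least two hyperedges are stars. The star chromatic number $\chi_s(H)$ is the minimum number of colors in a star coloring of $H$, and $$\chi_s^r(d)=\max\{\chi_s(H): H\subset K_n^r\text{ for some } n,\ \Delta(H)=d\},$$ i.e. the maximum is over all $r$-uniform hypergraphs $H$ with maximum degree $d$. *)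

(* Defs.v *)
From HB Require Import structures.
From mathcomp Require Import all_boot all_order all_algebra.
From mathcomp Require Import reals exp.

Set Implicit Arguments.
Unset Strict Implicit.
Unset Printing Implicit Defensive.

(* A hypergraph is its set of hyperedges H : {set {set T}}; its vertex set is
   cover H, and its subhypergraphs are the subsets F of H. *)
Section Hypergraph.
Variable T : finType.
Implicit Types H F : {set {set T}}.

Definition vdegree H (x : T) : nat := #|[set e in H | x \in e]|.

Definition max_degree H : nat := \max_(x in cover H) vdegree H x.

Definition complete_uniform (r : nat) : {set {set T}} :=
  [set e : {set T} | #|e| == r].

Definition adjacent F : rel T :=
  fun x y => [exists e in F, (x \in e) && (y \in e)].

Definition hconnected F : bool :=
  [forall x in cover F, forall y in cover F, connect (adjacent F) x y].

Definition is_star F : bool := (2 <= #|F|) && (\bigcap_(e in F) e != set0).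

Section Coloring.
Variables (C : finType) (c : {ffun T -> C}).

Definition monochromatic (e : {set T}) : bool :=
  [forall x in e, forall y in e, c x == c y].

Definition bicolored F : bool := #|c @: cover F| == 2.

Definition star_coloring H : bool :=
  [forall e in H, ~~ monochromatic e] &&
  [forall F : {set {set T}},
     [&& F \subset H, 2 <= #|F|, hconnected F & bicolored F] ==> is_star F].

End Coloring.

Definition star_colorable H (k : nat) : Prop :=
  exists c : {ffun T -> 'I_k}, star_coloring c H.

End Hypergraph.

Definition is_minimum (P : nat -> Prop) (m : nat) : Prop :=
  P m /\ forall k, P k -> m <= k.

Definition is_maximum (P : nat -> Prop) (m : nat) : Prop :=
  P m /\ forall k, P k -> k <= m.

(* Colors are also given to the elements of T outside cover H; as these occur
   in no condition, this does not affect the minimum when H is nonempty. *)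
Definition is_star_chromatic_number (T : finType) (H : {set {set T}}) :
  nat -> Prop := is_minimum (star_colorable H).

Definition is_max_star_chromatic_number (r d : nat) : nat -> Prop :=
  is_maximum (fun k => exists (n : nat) (H : {set {set 'I_n}}),
    [/\ H \subset complete_uniform 'I_n r, max_degree H = d &
        is_star_chromatic_number H k]).

(* Hypergraphs with a hyperedge of size at most 1 have no star chromatic
   number; the next lemmas show that r-uniform ones, r >= 3, always do. *)
Lemma star_colorable_card (T : finType) (H : {set {set T}}) :
  (forall e, e \in H -> 3 <= #|e|) -> star_colorable H #|T|.
Proof.
move=> H3; exists [ffun x => enum_rank x].
have inj_c : injective [ffun x : T => enum_rank x].
  by move=> x y; rewrite !ffunE => /enum_rank_inj.
apply/andP; split.
  apply/forall_inP => e /H3 e3; apply/negP => /forall_inP mono.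
  have : 1 < #|e| by apply: leq_trans e3.
  case/card_gt1P => x [y] [xe ye]; case/eqP; apply: inj_c.
  by apply/eqP; move/forall_inP: (mono x xe); apply.
apply/forallP => F; apply/implyP => /and4P[/subsetP sFH F2 _].
rewrite /bicolored card_imset // => /eqP F2v.
have /card_gt0P[e eF] : 0 < #|F| by apply: leq_trans F2.
have := leq_trans (H3 e (sFH e eF)) (subset_leq_card (bigcup_sup e eF)).
by rewrite -/(cover F) F2v.
Qed.

Lemma star_chromatic_number_exists (n r : nat) (H : {set {set 'I_n}}) :
  3 <= r -> H \subset complete_uniform 'I_n r ->
  exists k, is_star_chromatic_number H k.
Proof.
move=> r3 /subsetP Hr.
have ex : exists k, [exists c : {ffun 'I_n -> 'I_k}, star_coloring c H].
  exists #|'I_n|; apply/existsP; apply: star_colorable_card => e /Hr.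
  by rewrite inE => /eqP ->.
case: (ex_minnP ex) => k /existsP ck kmin; exists k; split=> // j cj.
by apply: kmin; apply/existsP.
Qed.

(* Main.v *)
Require Import Defs.
From HB Require Import structures.
From mathcomp Require Import all_boot all_order all_algebra.
From mathcomp Require Import reals exp.
From mathcomp Require Import boolp zify.

Import Order.TTheory GRing.Theory Num.Theory.
Local Open Scope ring_scope.

(** Write N for the number under the root, so that the bound is the least
    integer k with N <= k ^ (r - 1). It suffices to star color, with k colors,
    every r-uniform H of maximum degree d: as such H exist
    ([exists_max_degree]), the maximum then exists and is at most k. More is
    possible ([uniform_star_colorable]): a coloring without
    monochromatic hyperedge in which no connected subhypergraph with at least
    two hyperedges, star or not, is bicolored.

    In a connected F with two or more hyperedges, some hyperedge e is met by
    another one that contains a vertex y outside e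
    ([hconnected_neighbour]). If F is bicolored, then e and y together show at
    most two colors; so on r + 1 vertices, r - 1 colors are dictated by the
    two others, an event of probability about 2 ^ r / k ^ (r - 1). A vertex
    lies on at most d * (r d) * r + d * (r d) <= 2 (r d)^2 pairs (e, y), so
    such events are avoidable as soon as k ^ (r - 1) is at least a constant
    times 4 ^ r (r d)^2, and N is larger than this. A monochromatic hyperedge
    also dictates r - 1 colors, and is one of these events for y in e.

    Avoidability is a local lemma, proved by counting instead of by
    probabilities ([card_good_step]): let M(S) be the number of colorings
    violating no condition supported in S; by induction on S, adding one
    vertex to S at most halves M(S). A condition i dictates the colors of s
    vertices, the set free i, from the colors of the others; recoloring these
    s vertices arbitrarily shows that the colorings counted by M(S) and
    violating i number at most k ^ -s M(S - free i), which by induction is at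
    most (2 / k) ^ s M(S). Summing over the at most D conditions through the
    new vertex loses at most half of M(S) when 2 D 2 ^ s <= k ^ s. *)

(** * Unions, connectivity and degrees *)

Section Generalities.
Local Open Scope nat_scope.
Set Implicit Arguments.
Unset Strict Implicit.

Lemma leq_card_bigcup (I T : finType) (A : {set I}) (F : I -> {set T}) :
  #|\bigcup_(i in A) F i| <= \sum_(i in A) #|F i|.
Proof.
elim/big_rec2: _ => [|i m X _ le]; first by rewrite cards0.
by apply: leq_trans (leq_card_setU _ _) _; rewrite leq_add2l.
Qed.

Lemma leq_card_bigcup_const (I T : finType) (A : {set I}) (F : I -> {set T})
    a m :
  #|A| <= a -> (forall i, i \in A -> #|F i| <= m) ->
  #|\bigcup_(i in A) F i| <= a * m.
Proof.
move=> Aa Fm; apply: leq_trans (leq_card_bigcup A F) _.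
apply: (@leq_trans (\sum_(i in A) m)); first exact: leq_sum.
by rewrite sum_nat_const leq_mul2r Aa orbT.
Qed.

Lemma connect_exit (T : finType) (g : rel T) (A : {set T}) x y :
  x \in A -> y \notin A -> connect g x y ->
  exists u w, [/\ u \in A, w \notin A & g u w].
Proof.
move=> xA yA /connectP[p]; elim: p x xA => [|z p IH] x xA /=.
  by move=> _ yx; case/negP: yA; rewrite yx.
case/andP=> gxz pz yz; have [zA|zA] := boolP (z \in A); first exact: IH pz yz.
by exists x, z.
Qed.

(** A walk between vertices inside and outside a hyperedge has to leave it; the
    hyperedge crossed at that moment is the one sought. Uniformity excludes that
    all other hyperedges lie inside the first. *)
Lemma hconnected_neighbour (T : finType) (F : {set {set T}}) r :
  0 < r -> (forall e, e \in F -> #|e| = r) -> 1 < #|F| -> hconnected F ->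
  exists e f w, [/\ e \in F, f \in F, e :&: f != set0, w \in f & w \notin e].
Proof.
move=> r_gt0 Fr /card_gt1P[e [f [eF fF neq]]] /forall_inP conn.
have [x xe] : exists x, x \in e by apply/card_gt0P; rewrite Fr.
have /subsetPn[y yf ye] : ~~ (f \subset e).
  by apply: contra neq => fe; rewrite eq_sym eqEcard fe !Fr /=.
have inF z g : g \in F -> z \in g -> z \in cover F.
  by move=> gF zg; apply/bigcupP; exists g.
have /forall_inP/(_ y (inF y f fF yf)) := conn x (inF x e eF xe).
case/(connect_exit xe ye) => u [w [ue we]] /exists_inP[g gF /andP[ug wg]].
exists e, g, w; split=> //; apply/set0Pn; exists u; exact/setIP.
Qed.

Lemma vdegree_le (T : finType) (H : {set {set T}}) x :
  vdegree H x <= max_degree H.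
Proof.
have [xH|xH] := boolP (x \in cover H).
  rewrite /max_degree (bigD1 x) //=; exact: leq_maxl.
rewrite /vdegree; apply: leq_trans (leq0n _); rewrite leqn0 cards_eq0.
rewrite -subset0; apply/subsetP => e /setIdP[eH xe].
by case/negP: xH; apply/bigcupP; exists e.
Qed.
End Generalities.

(** * A local lemma by counting *)

Section LocalLemma.
Set Implicit Arguments.
Unset Strict Implicit.

Local Open Scope nat_scope.
Variables (T C I : finType) (supp free : I -> {set T}).
Variables (bad : I -> pred {ffun T -> C}) (s D : nat).

Implicit Types (S : {set T}) (c : {ffun T -> C}).

Hypothesis C_gt0 : 0 < #|C|.
Hypothesis s_gt0 : 0 < s.
Hypothesis card_free : forall i, #|free i| = s.
Hypothesis free_sub : forall i, free i \subset supp i.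
Hypothesis bad_local : forall i (c c' : {ffun T -> C}),
  {in supp i, c =1 c'} -> bad i c = bad i c'.
(* The quantitative content: a coloring violating i has no freedom on the s
   vertices of free i. *)
Hypothesis bad_determined : forall i (c c' : {ffun T -> C}),
  bad i c -> bad i c' ->
  {in ~: free i, c =1 c'} -> c = c'.
Hypothesis supp_degree : forall v, #|[set i | v \in supp i]| <= D.
Hypothesis colors_large : 2 * D * 2 ^ s <= #|C| ^ s.

Definition good (S : {set T}) : {set {ffun T -> C}} :=
  [set c | [forall i, (supp i \subset S) ==> ~~ bad i c]].

Lemma goodP S c :
  reflect (forall i, supp i \subset S -> ~~ bad i c) (c \in good S).
Proof.
rewrite inE; apply: (iffP forallP) => h i; first by apply/implyP.
by apply/implyP/h.
Qed.

Lemma good_anti S S' : S' \subset S -> good S \subset good S'.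
Proof.
move=> sS; apply/subsetP => c /goodP h; apply/goodP => i si.
by apply/h/(subset_trans si).
Qed.

(** A coloring that is good away from free i stays so under any of the
    #|C| ^ s recolorings of free i; since a bad coloring can be recovered from
    its values off free i, no two bad colorings share a recoloring. *)
Lemma card_good_bad i S :
  #|[set c in good (S :\: free i) | bad i c]| * #|C| ^ s
    <= #|good (S :\: free i)|.
Proof.
set A := free i; set X := [set c in _ | _].
pose G : finType := {ffun {x | x \in A} -> C}.
pose h (p : {ffun T -> C} * G) := [ffun x => oapp p.2 (p.1 x) (insub x)].
have hA p u : h p (val u) = p.2 u by rewrite ffunE valK.
have hN p x : x \notin A -> h p x = p.1 x by move=> xA; rewrite ffunE insubN.
have -> : #|C| ^ s = #|[set: G]|.
  by rewrite cardsT card_ffun card_sig -(card_free i).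
rewrite -cardsX -(card_in_imset (f := h)); last first.
  move=> [c g] [c' g']; rewrite !inE !andbT /= => /andP[_ bc] /andP[_ bc'] E.
  congr (_, _); last by apply/ffunP => u; rewrite -(hA (c, g)) E hA.
  apply: (bad_determined bc bc') => x; rewrite inE => xA.
  by rewrite -(hN (c, g)) // E hN.
apply/subset_leq_card/subsetP => _ /imsetP[[c g] + ->].
rewrite in_setX => /andP[/setIdP[/goodP gc _] _] /=.
apply/goodP => j sj; rewrite -(bad_local (c := c)) ?gc // => x xj.
by rewrite hN //; move/subsetP: sj => /(_ x xj); rewrite inE => /andP[].
Qed.

(** Adding the vertices of S :\: S' one by one. The one-vertex inequality is
    assumed only below the size of S, which is what an induction on that size
    provides in the next proof. *)
Lemma card_good_chain S S' :
  (forall R : {set T}, #|R| < #|S| ->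
     forall v, #|good R| <= 2 * #|good (v |: R)|) ->
  S' \subset S -> #|good S'| <= 2 ^ #|S :\: S'| * #|good S|.
Proof.
move=> IH; move En: #|_ :\: _| => n; elim: n S' En => [|n IHn] S' En sS.
  move/eqP: En; rewrite cards_eq0 setD_eq0 => sS'.
  by rewrite mul1n; apply/subset_leq_card/good_anti.
have /card_gt0P[v] : 0 < #|S :\: S'| by rewrite En.
rewrite inE => /andP[vS' vS].
have ltS : #|S'| < #|S| by apply/proper_card/properP; split => //; exists v.
apply: leq_trans (IH S' ltS v) _; rewrite expnS -mulnA leq_mul2l /=.
apply: IHn; last by rewrite subUset sub1set vS.
rewrite setUC -setDDl; have := cardsD1 v (S :\: S').
by rewrite En inE vS' vS add1n => -[].
Qed.

(** Good colorings lost when v joins S violate a condition through v, and for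
    each such condition at most a fraction (2 / #|C|) ^ s of good S does. *)
Lemma card_good_step S (v : T) : #|good S| <= 2 * #|good (v |: S)|.
Proof.
have [n] := ubnP #|S|; elim: n S v => // n IHn S v leSn.
have chain S' : S' \subset S -> #|good S'| <= 2 ^ #|S :\: S'| * #|good S|.
  by apply: card_good_chain => R ltR w; apply/IHn/(leq_trans ltR).
set loss := good S :\: good (v |: S).
have lossE : #|good S| = #|good (v |: S)| + #|loss|.
  by rewrite -(cardsID (good (v |: S))) (setIidPr (good_anti _)) ?subsetUr.
pose lossi i := [set c in good S | bad i c].
have lossi_le i : #|lossi i| * #|C| ^ s <= 2 ^ s * #|good S|.
  apply: leq_trans (_ : #|good (S :\: free i)| <= _).
    apply: leq_trans (card_good_bad i S); rewrite leq_mul2r; apply/orP; right.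
    apply/subset_leq_card/subsetP => c /setIdP[gc bc]; apply/setIdP.
    by split=> //; apply: subsetP gc; apply/good_anti/subsetDl.
  apply: leq_trans (chain _ (subsetDl _ _)) _; rewrite leq_mul2r leq_exp2l //.
  rewrite -(card_free i); apply/orP; right; apply/subset_leq_card.
  by apply/subsetP => x; rewrite !inE; case: (x \in S); rewrite ?andbF // !andbT negbK.
have loss_le : #|loss| <= \sum_(i in [set i | v \in supp i]) #|lossi i|.
  apply: leq_trans (_ : #|\bigcup_(i in [set i | v \in supp i]) lossi i| <= _).
    apply/subset_leq_card/subsetP => c /setDP[gS].
    rewrite inE => /forallPn[i]; rewrite negb_imply negbK => /andP[si bi].
    (* Otherwise supp i already lies in S, where c is good. *)
    have vi : v \in supp i.
      apply: contraLR bi => vi; move/goodP: gS; apply.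
      apply/subsetP => x xi; move/subsetP: si => /(_ x xi).
      by rewrite !inE => /orP[/eqP xv|//]; rewrite -xv xi in vi.
    by apply/bigcupP; exists i; [rewrite in_set | apply/setIdP].
  exact: leq_card_bigcup.
have k_gt0 : 0 < #|C| ^ s by rewrite expn_gt0 C_gt0.
have : #|loss| * #|C| ^ s <= D * (2 ^ s * #|good S|).
  apply: leq_trans (_ : _ <= #|[set i | v \in supp i]| * (2 ^ s * #|good S|)) _.
    rewrite -[X in _ <= X]sum_nat_const.
    apply: leq_trans (_ : _ <= \sum_(i in [set i | v \in supp i])
      #|lossi i| * #|C| ^ s) _; last by apply: leq_sum => i _.
    by rewrite -big_distrl leq_mul2r loss_le orbT.
  by rewrite leq_mul2r supp_degree orbT.
rewrite -(leq_pmul2l (isT : 0 < 2)) => le.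
have : (2 * #|loss|) * #|C| ^ s <= #|good S| * #|C| ^ s.
  rewrite -mulnA; apply: leq_trans le _.
  by rewrite !mulnA mulnC leq_mul2l colors_large orbT.
rewrite leq_pmul2r // lossE; lia.
Qed.

Lemma exists_good_coloring : exists c, forall i, ~~ bad i c.
Proof.
have : 0 < #|good set0|.
  have /card_gt0P[a _] := C_gt0; apply/card_gt0P; exists [ffun=> a].
  apply/goodP => i; rewrite subset0 => /eqP s0; have := free_sub i.
  by rewrite s0 subset0 -cards_eq0 card_free eqn0Ngt s_gt0.
move/leq_trans/(_ (card_good_chain (S := setT) _ (sub0set _))).
move=> /(_ (fun R _ => card_good_step R)); rewrite muln_gt0 => /andP[_].
case/card_gt0P => c /goodP gc; exists c => i; exact/gc/subsetT.
Qed.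
End LocalLemma.

(** * Coloring a uniform hypergraph *)

Section StarColoring.
Local Open Scope nat_scope.
Set Implicit Arguments.
Unset Strict Implicit.
Variables (T : finType) (H : {set {set T}}) (r d k : nat).
Hypothesis r_gt1 : 1 < r.
Hypothesis H_uniform : forall e, e \in H -> #|e| = r.
Hypothesis H_degree : forall x, vdegree H x <= d.
Hypothesis k_gt0 : 0 < k.
Hypothesis k_large : 2 ^ (2 * r + 1) * (r * d) ^ 2 <= k ^ r.-1.

Definition neighbours (e : {set T}) := [set f in H | e :&: f != set0].

Lemma card_neighbours e : e \in H -> #|neighbours e| <= r * d.
Proof.
move=> eH.
apply: leq_trans (_ : #|\bigcup_(x in e) [set f in H | x \in f]| <= _).
  apply/subset_leq_card/subsetP => f /setIdP[fH /set0Pn[x /setIP[xe xf]]].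
  by apply/bigcupP; exists x; rewrite // inE fH.
by apply: leq_card_bigcup_const => [|x _]; [rewrite H_uniform | apply: H_degree].
Qed.

(** A pattern (e, y, Z) splits the vertices of e into those of Z, to be colored
    alike, and the others, to be colored like y. The last condition places a y
    of e in Z: were it in e :\: Z, the two classes would leave two colors of e
    undetermined, so that only r - 2 vertices would be dictated by the others.
    Taking Z = e and y in e (e is one of its own neighbours) gives the monochromatic
    hyperedges, also when e meets no other hyperedge. *)
Definition is_pattern (p : {set T} * T * {set T}) :=
  let: (e, y, Z) := p in
  [&& e \in H, y \in cover (neighbours e), Z \subset e, Z != set0
    & y \notin e :\: Z].

Definition pattern := {p | is_pattern p}.

Definition edge (p : pattern) := (val p).1.1.
Definition extra (p : pattern) := (val p).1.2.
Definition part (p : pattern) := (val p).2.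
(** The vertex of Z whose color dictates that of Z; the default value is never
    reached, Z being nonempty. *)
Definition rep (p : pattern) := odflt (extra p) [pick a in part p].

Definition follows (p : pattern) (c : {ffun T -> 'I_k}) :=
  [forall x in edge p, c x == c (if x \in part p then rep p else extra p)].

Lemma patternP p :
  [/\ edge p \in H, extra p \in cover (neighbours (edge p)),
      part p \subset edge p, rep p \in part p & extra p \notin edge p :\: part p].
Proof.
rewrite /rep; case: pickP => [a|] /=.
  by case: p a => [[[e y] Z] ip] a aZ; case/and5P: (ip).
case: p => [[[e y] Z] ip] Z0; case/and5P: (ip) => _ _ _ /set0Pn[a aZ] _.
by have := Z0 a; rewrite /part /= aZ.
Qed.

Lemma follows_local p (c c' : {ffun T -> 'I_k}) :
  {in extra p |: edge p, c =1 c'} -> follows p c = follows p c'.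
Proof.
have [_ _ /subsetP sZ aZ _] := patternP p.
move=> E; apply: eq_forallb => x; case xe: (x \in edge p) => //=.
rewrite (E x) ?in_setU1 ?xe ?orbT // E //.
by case: ifP => _; rewrite in_setU1 ?eqxx // sZ ?orbT.
Qed.

(** Off e :\ rep p one reads the color of the representative, hence that of Z,
    and the color of y: either y is outside e, or it belongs to Z. *)
Lemma follows_determined p (c c' : {ffun T -> 'I_k}) :
  follows p c -> follows p c' ->
  {in ~: (edge p :\ rep p), c =1 c'} -> c = c'.
Proof.
have [_ _ /subsetP sZ aZ yZ] := patternP p.
move=> /forall_inP fc /forall_inP fc' E.
have Ea : c (rep p) = c' (rep p) by apply: E; rewrite !inE eqxx.
have Ey : c (extra p) = c' (extra p).
  have [ye|ye] := boolP (extra p \in edge p); last first.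
    by apply: E; rewrite !inE (negPf ye) andbF.
  have yZ' : extra p \in part p by move: yZ; rewrite inE ye andbT negbK.
  by have /eqP := fc _ ye; have /eqP := fc' _ ye; rewrite yZ' Ea => -> ->.
apply/ffunP => x; have [xe|xe] := boolP (x \in edge p); last first.
  by apply: E; rewrite !inE (negPf xe) andbF.
rewrite (eqP (fc x xe)) (eqP (fc' x xe)); by case: ifP.
Qed.

(** Either v lies in e: d choices for e, r d for a hyperedge meeting e, r for y
    in it. Or v is y: d choices for a hyperedge containing it, r d for e meeting
    that one. In both cases Z is one of 2 ^ r subsets of e. *)
Lemma card_pattern_at v :
  #|[set p : pattern | v \in extra p |: edge p]| <= 2 ^ r.+1 * (r * d) ^ 2.
Proof.
pose sub (e : {set T}) (y : T) := [set (e, y, Z) | Z in powerset e].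
have card_sub e y : e \in H -> #|sub e y| <= 2 ^ r.
  move=> eH; apply: leq_trans (leq_imset_card _ _) _.
  by rewrite card_powerset H_uniform.
pose H_ x := [set e in H | x \in e].
pose near := \bigcup_(e in H_ v) \bigcup_(f in neighbours e)
  \bigcup_(y in f) sub e y.
pose far := \bigcup_(f in H_ v) \bigcup_(e in neighbours f) sub e v.
rewrite -(card_imset _ val_inj).
apply: leq_trans (_ : #|near :|: far| <= _).
  apply/subset_leq_card/subsetP => _ /imsetP[p + ->]; rewrite inE.
  case: p => [[[e y] Z] ip]; case/and5P: (ip) => eH.
  case/bigcupP=> f /setIdP[fH ef] yf Ze _ _.
  have Zsub : (e, y, Z) \in sub e y by apply: imset_f; rewrite inE.
  rewrite /extra /edge /= in_setU1 => /orP[/eqP vy|ve]; apply/setUP; [right|left].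
    rewrite -vy in yf Zsub *; apply/bigcupP; exists f; first by rewrite inE fH.
    by apply/bigcupP; exists e => //; apply/setIdP; rewrite setIC.
  apply/bigcupP; exists e; first by rewrite inE eH.
  by apply/bigcupP; exists f; [rewrite inE fH | apply/bigcupP; exists y].
have near_le : #|near| <= d * ((r * d) * (r * 2 ^ r)).
  apply: leq_card_bigcup_const => [|e /setIdP[eH _]]; first exact: H_degree.
  apply: leq_card_bigcup_const => [|f /setIdP[fH _]]; first exact: card_neighbours.
  apply: leq_card_bigcup_const => [|y _]; first by rewrite H_uniform.
  exact: card_sub.
have far_le : #|far| <= d * ((r * d) * 2 ^ r).
  apply: leq_card_bigcup_const => [|f /setIdP[fH _]]; first exact: H_degree.
  apply: leq_card_bigcup_const => [|e /setIdP[eH _]]; first exact: card_neighbours.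
  exact: card_sub.
apply: leq_trans (leq_card_setU _ _) _.
apply: leq_trans (leq_add near_le far_le) _.
rewrite expnS; move: (2 ^ r) => q; move: r_gt1; nia.
Qed.

Lemma exists_pattern_free : exists c : {ffun T -> 'I_k}, forall p, ~~ follows p c.
Proof.
apply: (@exists_good_coloring _ _ _ (fun p => extra p |: edge p)
  (fun p => edge p :\ rep p) _ r.-1 (2 ^ r.+1 * (r * d) ^ 2)).
- by rewrite card_ord.
- by rewrite -ltnS prednK // ltnW.
- move=> p; have [eH _ /subsetP sZ aZ _] := patternP p.
  by rewrite -(H_uniform eH) (cardsD1 (rep p) (edge p)) sZ.
- by move=> p; apply: subset_trans (subsetUr _ _); apply: subD1set.
- exact: follows_local.
- exact: follows_determined.
- exact: card_pattern_at.
rewrite card_ord; apply: leq_trans k_large.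
have -> : 2 ^ (2 * r + 1) = 2 * 2 ^ r.+1 * 2 ^ r.-1.
  by rewrite -expnS -expnD; congr (2 ^ _); lia.
by rewrite mulnA mulnAC.
Qed.

(** The coloring obtained satisfies the second requirement vacuously: connected
    bicolored subhypergraphs with two hyperedges do not exist. *)
Lemma uniform_star_colorable : star_colorable H k.
Proof.
have [c freec] := exists_pattern_free; exists c.
have nofollow e y Z : is_pattern (e, y, Z) ->
    ~ (exists al, forall x, x \in e -> c x = if x \in Z then al else c y).
  move=> ip [al al_e]; pose p : pattern := exist _ (e, y, Z) ip.
  have := freec p => /negP; apply; apply/forall_inP => x xe.
  have [_ _ /subsetP sZ aZ _] := patternP p.
  rewrite -[part p]/Z in sZ aZ *; rewrite al_e //.
  by case: ifP => xZ //; rewrite al_e ?aZ //; apply: sZ.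
have nomono e : e \in H -> ~~ monochromatic c e.
  move=> eH; apply/negP => /forall_inP mono.
  have [a ae] : exists a, a \in e by apply/card_gt0P; rewrite H_uniform // ltnW.
  apply: (nofollow e a e).
    rewrite /is_pattern eH subxx setDv in_set0 !andbT /=.
    have e0 : e != set0 by apply/set0Pn; exists a.
    by rewrite e0 andbT; apply/bigcupP; exists e; rewrite // inE eH setIid.
  exists (c a) => x xe; rewrite xe; apply/eqP.
  by move/forall_inP: (mono x xe); apply.
apply/andP; split; first by apply/forall_inP.
apply/forallP => F; apply/implyP => /and4P[/subsetP sFH F2 connF bicF].
have F_uniform e : e \in F -> #|e| = r by move/sFH/H_uniform.
have [e [f [w [eF fF ef wf we]]]] :=
  hconnected_neighbour (ltnW r_gt1) F_uniform F2 connF.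
have inF z g : g \in F -> z \in g -> c z \in c @: cover F.
  by move=> gF zg; apply/imset_f/bigcupP; exists g.
have [al al_e] : exists al, forall x, x \in e -> c x != c w -> c x = al.
  have : #|(c @: cover F) :\ c w| == 1.
    by move: bicF; rewrite /bicolored (cardsD1 (c w)) (inF w f).
  case/cards1P => al E; exists al => x xe xw; apply/set1P.
  by rewrite -E !inE xw (inF x e).
(* Z is empty only if e is monochromatic. *)
pose Z := [set x in e | c x != c w].
case: (nofollow e w Z).
  rewrite /is_pattern sFH // inE (negPf we) andbF andbT /=.
  apply/and3P; split; first by apply/bigcupP; exists f; rewrite // inE sFH.
    by apply/subsetP => x /setIdP[].
  apply: contra (nomono e (sFH e eF)) => /eqP Z0.
  have mono x : x \in e -> c x = c w.
    move=> xe; apply/eqP; have : x \notin Z by rewrite Z0 inE.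
    by rewrite inE xe negbK.
  by apply/forall_inP => x xe; apply/forall_inP => y ye; rewrite !mono.
exists al => x xe; rewrite inE xe /=; case: eqP => [//|/eqP xw]; exact: al_e.
Qed.
End StarColoring.

(** * The maximum star chromatic number *)

(** A common core A of r - 1 >= 1 vertices, completed by d distinct vertices:
    the core vertices have degree d, the number of hyperedges. *)
Lemma exists_max_degree (r d : nat) : (1 < r)%N ->
  exists (n : nat) (H : {set {set 'I_n}}),
    H \subset complete_uniform 'I_n r /\ max_degree H = d.
Proof.
case: r => // r; rewrite ltnS => r_gt0.
pose A : {set 'I_(r + d)} := [set lshift d i | i : 'I_r].
have rA i : rshift r i \notin A.
  by apply/negP => /imsetP[j _ /eqP]; rewrite eq_rlshift.
pose edge i := rshift r i |: A.
pose H := [set edge i | i : 'I_d].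
have cardH : #|H| = d.
  rewrite card_imset ?card_ord // => i j /setP/(_ (rshift r i)).
  by rewrite setU11 in_setU1 (negPf (rA i)) orbF => /esym/eqP/rshift_inj.
exists (r + d)%N, H; split.
  apply/subsetP => _ /imsetP[i _ ->]; rewrite inE cardsU1 rA.
  by rewrite card_imset ?card_ord //; exact: lshift_inj.
apply/eqP; rewrite eqn_leq; apply/andP; split.
  apply/bigmax_leqP => x _; rewrite -[leqRHS]cardH.
  by apply/subset_leq_card/subsetP => e /setIdP[].
pose x := lshift d (Ordinal r_gt0).
have xA : x \in A by apply: imset_f.
apply: leq_trans (vdegree_le H x); rewrite -[leqLHS]cardH.
apply/subset_leq_card/subsetP => e eH; rewrite inE eH /=.
by case/imsetP: eH => i _ ->; rewrite in_setU1 xA orbT.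
Qed.

Lemma leq_root_ceil (R : realType) (N s k : nat) : (0 < s)%N ->
  k%:Z = Num.ceil ((N%:R : R) `^ (1 / s%:R)) -> (N <= k ^ s)%N.
Proof.
move=> s_gt0 kE; rewrite -(ler_nat R) natrX.
have {1}-> : N%:R = ((N%:R : R) `^ (1 / s%:R)) ^+ s.
  rewrite -powR_mulrn ?powR_ge0 // -powRrM div1r mulVf ?powRr1 ?ler0n //.
  by rewrite pnatr_eq0 -lt0n.
rewrite lerXn2r ?nnegrE ?powR_ge0 ?ler0n //.
by apply: le_trans (ceil_ge _) _; rewrite -kE.
Qed.

Theorem corollary3 (R : realType) (r d : nat) (hr : (3 <= r)%N) (hd : (1 <= d)%N) :
  exists2 chi : nat,
    is_max_star_chromatic_number r d chi &
    chi%:Z <= Num.ceil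
      ((2 ^+ (3 * r + 1) * 3 ^+ 3 * (r%:R * d%:R) ^+ 3 : R) `^ (1 / (r%:R - 1))).
Proof.
have r_gt0 : (0 < r)%N by apply: leq_trans hr.
have s_gt0 : (0 < r.-1)%N by rewrite -ltnS prednK // ltnW.
set X : R := _ * _; set q := X `^ _.
pose N := (2 ^ (3 * r + 1) * 3 ^ 3 * (r * d) ^ 3)%N.
have XE : X = N%:R by rewrite /X -natrM -!natrX -!natrM.
have qE : q = (N%:R : R) `^ (1 / r.-1%:R).
  by rewrite /q XE -[in RHS]subn1 natrB.
have [k kE] : exists k : nat, k%:Z = Num.ceil q.
  exists `|Num.ceil q|%N; apply: gez0_abs.
  by rewrite -(ceil0 R) le_ceil // powR_ge0.
have Nk : (N <= k ^ r.-1)%N by apply: (@leq_root_ceil R); rewrite // kE qE.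
have N_gt0 : (0 < N)%N by rewrite /N !muln_gt0 !expn_gt0 ?muln_gt0 r_gt0 hd.
have k_gt0 : (0 < k)%N.
  rewrite lt0n; apply: contraTneq Nk => ->.
  by rewrite exp0n // leqn0 -lt0n.
have k_large : (2 ^ (2 * r + 1) * (r * d) ^ 2 <= k ^ r.-1)%N.
  apply: leq_trans Nk; rewrite leq_mul //; last first.
    by rewrite leq_pexp2l // muln_gt0 r_gt0.
  by rewrite -[leqLHS]muln1 leq_mul // leq_exp2l // leq_add2r leq_mul2r orbT.
pose P m := `[< exists (n : nat) (H : {set {set 'I_n}}),
    [/\ H \subset complete_uniform 'I_n r, max_degree H = d &
        is_star_chromatic_number H m] >].
have P_le m : P m -> (m <= k)%N.
  case/asboolP => n [H [/subsetP Hr Hd [_ m_min]]]; apply: m_min.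
  apply: (@uniform_star_colorable _ H r d) => //.
  - exact: ltnW.
  - by move=> e /Hr; rewrite inE => /eqP.
  - by move=> x; rewrite -Hd vdegree_le.
have P_ex : exists m, P m.
  have [n [H [Hr Hd]]] := @exists_max_degree r d (ltnW hr).
  have [m Hm] := star_chromatic_number_exists hr Hr.
  by exists m; apply/asboolP; exists n, H.
case: (ex_maxnP P_ex P_le) => chi Pchi chi_max; exists chi.
  split; first exact/asboolP.
  by move=> j Pj; apply: chi_max; apply/asboolP.
by rewrite -kE lez_nat P_le.
Qed.
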